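(* Let $R$ be an integral domain and assume that each $t$-prime ideal of $R$ is contained in a unique $t$-maximal ideal (e.g., $R$ has $t$-dimension one). Then the following conditions are equivalent: (i) $R$ is Clifford $t$-regular (respectively, $t$-stable); (ii) $R_M$ is Clifford $t_M$-regular (respectively, $t_M$-stable) for each $M\in t\text{-Max}(R)$, and $R$ has $t$-finite character.
   Context: For an integral domain $R$ with field of fractions $K$, an ideal means a nonzero fractional ideal (integral if contained in $R$); prime ideals are integral and nonzero; $(J:I)=\{x\in K: xI\subseteq J\}$. $I^v=(R:(R:I))$ and $I^t=\bigcup\{J^v: J\subseteq I \text{ a finitely generated ideal}\}$. $I$ is a $t$-ideal if $I=I^t$; a $t$-prime is a prime ideal that is a $t$-ideal; a $t$-maximal ideal is a maximal element of the set of proper integral $t$-ideals; $t\text{-Max}(R)$ is the set of these. $R$ has $t$-dimension one if each $t$-prime has height one. $R$ has $t$-finite character if each nonzero element of $R$ lies in at most finitely many $t$-maximal ideals. $t_M$ denotes the $t$-operation of the domain $R_M$. $R$ is Clifford $t$-regular if for every ideal $I$ of $R$ there is an ideal $J$ of $R$ with $I^t=(I^2J)^t$. $R$ is $t$-stable if for every ideal $I$ of $R$, with $E:=(I^t:I^t)$, one has $(I^t(E:I^t))^t=E$, where $t$ is the $t$-operation of $R$. The same definitions are applied to $R_M$ with $t_M$. The statement is to be read as two equivalences: one for Clifford regularity and one for stability. *)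

(* Defs.v *)
From mathcomp Require Import all_boot all_order all_algebra.
From mathcomp Require Import fraction.
From mathcomp Require Import all_classical.

Set Implicit Arguments.
Unset Strict Implicit.
Unset Printing Implicit Defensive.

Import GRing.Theory.
Local Open Scope ring_scope.
Local Open Scope classical_set_scope.

(* A domain is represented by the set D of its elements inside a fixed field  *)
(* K, which is meant to be its field of fractions.  Thus a domain and its     *)
(* localizations live in the same field, and each notion below (in particular *)
(* the t-operation) is relative to the domain D it is given.                  *)
Section Domain.

Variables (K : fieldType) (D : set K).
Implicit Types I J M P A B : set K.

Definition submodule I : Prop :=
  [/\ I 0,
      (forall x y, I x -> I y -> I (x + y)) &
      (forall a x, D a -> I x -> I (a * x))].

(* "Ideal" means nonzero fractional ideal. *)
Definition ideal I : Prop :=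
  [/\ submodule I,
      (exists2 x, I x & x != 0) &
      (exists d, [/\ D d, d != 0 & forall x, I x -> D (d * x)])].

Definition span_of n (g : 'I_n -> K) : set K :=
  [set x | exists a : 'I_n -> K,
     (forall i, D (a i)) /\ x = \sum_(i < n) a i * g i].

Definition finitely_generated I : Prop :=
  exists n (g : 'I_n -> K), I = span_of g.

Definition colon J I : set K := [set x | forall y, I y -> J (x * y)].

Definition ideal_mul A B : set K :=
  [set x | exists n (a b : 'I_n -> K),
     [/\ (forall i, A (a i)), (forall i, B (b i)) &
         x = \sum_(i < n) a i * b i]].

Definition v_op I : set K := colon D (colon D I).

Definition t_op I : set K :=
  [set x | exists J, [/\ ideal J, finitely_generated J, J `<=` I & v_op J x]].

Definition t_ideal I : Prop := ideal I /\ I = t_op I.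

Definition prime_ideal P : Prop :=
  [/\ ideal P, P `<=` D, P <> D &
      forall a b, D a -> D b -> P (a * b) -> P a \/ P b].

Definition t_prime P : Prop := prime_ideal P /\ t_ideal P.

Definition proper_integral_t_ideal I : Prop :=
  [/\ t_ideal I, I `<=` D & I <> D].

Definition t_maximal M : Prop :=
  proper_integral_t_ideal M /\
  forall I, proper_integral_t_ideal I -> M `<=` I -> I = M.

Definition t_finite_character : Prop :=
  forall x, D x -> x != 0 -> finite_set [set M | t_maximal M /\ M x].

Definition clifford_t_regular : Prop :=
  forall I, ideal I ->
    exists2 J, ideal J & t_op I = t_op (ideal_mul (ideal_mul I I) J).

Definition t_stable : Prop :=
  forall I, ideal I ->
    let E := colon (t_op I) (t_op I) in
    t_op (ideal_mul (t_op I) (colon E (t_op I))) = E.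

Definition localization M : set K :=
  [set x | exists a s, [/\ D a, D s, ~ M s & x = a / s]].

End Domain.

Definition domain_in_fractions (R : idomainType) : set {fraction R} :=
  range (@tofrac R).
Arguments domain_in_fractions R : clear implicits.

(* Main.v *)
Require Import Defs.
From mathcomp Require Import all_boot all_order all_algebra.
From mathcomp Require Import fraction generic_quotient ring.
From mathcomp Require Import all_classical.

(* The hypothesis makes distinct t-maximal ideals M, N independent: every c in K
   satisfies s c in D_N for some s in D \ M.
   - Finite character.  Let D be Clifford t-regular and x in M nonzero.  By
     independence, Q = x D_M /\ D generates D_N for every N <> M.  The equation
     Q = (Q^2 J)^t forces B_M = {y in D | y Q <= x D}, which contains x J, not to
     be contained in M; again by independence B_M lies in every N <> M
     containing x.  Hence no t-maximal ideal contains x and all the B_M, so x and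
     finitely many of the B_M generate D up to t-closure, and the corresponding M
     are the only t-maximal ideals above x.
   - Descent to D_M.  If A is a D-ideal with A D_M = I, the equation for A
     localizes, because A^t is contained in the t_M-closure of I.
   - Gluing.  With finite character, independence can be applied at all N <> M
     at once: every c in K has some u in D \ M with u c in D_N for all N <> M.
     Hence the t-closure and the colons of t-ideals commute with localization.
     Regularity of I is equivalent to I^t = (I^2 (I^t : I^2))^t, and stability is
     also an equation between t-closed sets, so both can be checked locally. *)

Set Implicit Arguments.
Unset Strict Implicit.
Unset Printing Implicit Defensive.

Import GRing.Theory.
Local Open Scope quotient_scope.
Local Open Scope ring_scope.
Local Open Scope classical_set_scope.

Lemma mem_cat_all (T : eqType) (P : T -> Prop) (s1 s2 : seq T) :
  (forall x, x \in s1 -> P x) -> (forall x, x \in s2 -> P x) ->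
  forall x, x \in s1 ++ s2 -> P x.
Proof. by move=> P1 P2 x; rewrite mem_cat => /orP[/P1|/P2]. Qed.

(** The interface shared by [domain_in_fractions R] and its localizations inside [K], so that the
    same lemmas serve both. Closure under subtraction supplies zero and opposites. *)
Definition fraction_domain {K : fieldType} (D : set K) : Prop :=
  [/\ D 1, (forall x y, D x -> D y -> D (x - y)),
      (forall x y, D x -> D y -> D (x * y)) &
      (forall x, exists a b, [/\ D a, D b, b != 0 & x = a / b])].

(** For a prime [M] and a [D]-submodule [A] this is the extension of [A] to D_M, and [loc D M D] is
    D_M itself. *)
Definition loc {K : fieldType} (D M A : set K) : set K :=
  [set x | exists s, [/\ D s, ~ M s & A (s * x)]].

(* The union of the [F^v] over the finite subsets [F] of [I]; unlike [t_op],
   it makes sense, and is a closure operator, on arbitrary sets [I]. *)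
Definition t_closure {K : fieldType} (D I : set K) : set K :=
  [set x | exists2 s : seq K, (forall g, g \in s -> I g) &
     forall y, (forall g, g \in s -> D (y * g)) -> D (x * y)].

(** * Fractional ideals, colons and the t-closure *)

Section Closure.
Context {K : fieldType} {D : set K}.
Hypothesis domD : fraction_domain D.
Implicit Types A B I J M : set K.

Lemma dom1 : D 1. Proof. by case: domD. Qed.

Lemma dom_sub {x y} : D x -> D y -> D (x - y).
Proof. by case: domD => _ + _ _; apply. Qed.

Lemma dom_mul {x y} : D x -> D y -> D (x * y).
Proof. by case: domD => _ _ + _; apply. Qed.

Lemma dom_frac x : exists a b, [/\ D a, D b, b != 0 & x = a / b].
Proof. by case: domD. Qed.

Lemma dom0 : D 0. Proof. by rewrite -(subrr 1); apply: dom_sub dom1 dom1. Qed.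

Lemma dom_opp {x} : D x -> D (- x).
Proof. by move=> Dx; rewrite -sub0r; apply: dom_sub dom0 Dx. Qed.

Lemma dom_add {x y} : D x -> D y -> D (x + y).
Proof. by move=> Dx Dy; rewrite -(opprK y); apply: dom_sub Dx (dom_opp Dy). Qed.

Lemma submodule_dom : submodule D D.
Proof. by split; [exact: dom0 | exact: @dom_add | exact: @dom_mul]. Qed.

Lemma submodule_sum A n (f : 'I_n -> K) :
  submodule D A -> (forall i, A (f i)) -> A (\sum_(i < n) f i).
Proof. by move=> [A0 AD _] Af; elim/big_ind: _. Qed.

Lemma mem_ideal_mul A B a b : A a -> B b -> ideal_mul A B (a * b).
Proof.
move=> Aa Bb; exists 1%N, (fun=> a), (fun=> b).
by split=> //; rewrite big_ord1.
Qed.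

Lemma ideal_mul_sub A B C : submodule D C ->
  (forall a b, A a -> B b -> C (a * b)) -> ideal_mul A B `<=` C.
Proof.
move=> smC ABC _ [n [a [b [Aa Bb ->]]]].
by apply: submodule_sum => // i; apply: ABC.
Qed.

Lemma submodule_mul A B : submodule D A -> submodule D (ideal_mul A B).
Proof.
move=> [_ _ AZ]; split.
- exists 0%N, (fun=> 0), (fun=> 0).
  by split; [case | case | rewrite big_ord0].
- move=> _ _ [m [a [b [Aa Bb ->]]]] [n [c [d [Ac Bd ->]]]].
  exists (m + n)%N,
    (fun i : 'I_(m + n) =>
       match fintype.split i with inl j => a j | inr j => c j end),
    (fun i : 'I_(m + n) =>
       match fintype.split i with inl j => b j | inr j => d j end); split.
  + by move=> i; case: fintype.split.
  + by move=> i; case: fintype.split.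
  + rewrite big_split_ord /=; congr (_ + _); apply: eq_bigr => i _.
      by rewrite -[lshift n i]/(unsplit (inl i)) unsplitK.
    by rewrite -[rshift m i]/(unsplit (inr i)) unsplitK.
- move=> r _ Dr [n [a [b [Aa Bb ->]]]]; exists n, (fun i => r * a i), b; split=> //.
    by move=> i; apply: AZ.
  by rewrite mulr_sumr; apply: eq_bigr => i _; rewrite mulrA.
Qed.

Lemma submodule_colon A B : submodule D A -> submodule D (colon A B).
Proof.
move=> [A0 AD AZ]; split => [b _|x y Ax Ay b Bb|r x Dr Ax b Bb].
- by rewrite mul0r.
- by rewrite mulrDl; apply: AD; [apply: Ax | apply: Ay].
- by rewrite -mulrA; apply: AZ => //; apply: Ax.
Qed.

Lemma submodule_scale c A : submodule D A -> submodule D [set y | A (c * y)].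
Proof.
move=> [A0 AD AZ]; split=> [|x y /= Ax Ay|r x /= Dr Ax] /=.
- by rewrite mulr0.
- by rewrite mulrDr; apply: AD.
- by rewrite mulrCA; apply: AZ.
Qed.

Lemma submoduleI A B : submodule D A -> submodule D B -> submodule D (A `&` B).
Proof.
move=> [A0 AD AZ] [B0 BD BZ].
by split=> [|x y [? ?] [? ?]|r x ? [? ?]]; split; auto.
Qed.

Lemma ideal_submodule I : ideal D I -> submodule D I. Proof. by case. Qed.

Lemma ideal_neq0 I : ideal D I -> exists2 x, I x & x != 0.
Proof. by case. Qed.

Lemma ideal_den I : ideal D I ->
  exists d, [/\ D d, d != 0 & forall x, I x -> D (d * x)].
Proof. by case. Qed.

Lemma ideal_dom : ideal D D.
Proof.
split; [exact: submodule_dom | by exists 1; [exact: dom1 | exact: oner_neq0] |].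
by exists 1; split; [exact: dom1 | exact: oner_neq0 | move=> x; rewrite mul1r].
Qed.

Lemma ideal_mul3_sub A B F C : submodule D C ->
  (forall a b c, A a -> B b -> F c -> C (a * b * c)) ->
  ideal_mul (ideal_mul A B) F `<=` C.
Proof.
move=> smC ABFC; apply: ideal_mul_sub => // z c ABz Fc; rewrite mulrC.
move: z ABz; apply: (ideal_mul_sub (submodule_scale c smC)) => a b Aa Bb /=.
by rewrite mulrC; apply: ABFC.
Qed.

Lemma ideal_mul_ideal A B : ideal D A -> ideal D B -> ideal D (ideal_mul A B).
Proof.
move=> [smA [a Aa a0] [d [Dd d0 dA]]] [smB [b Bb b0] [e [De e0 eB]]]; split.
- exact: submodule_mul.
- by exists (a * b); [apply: mem_ideal_mul | rewrite mulf_neq0].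
- exists (d * e); split; [exact: dom_mul | by rewrite mulf_neq0 |].
  apply: ideal_mul_sub; first exact: submodule_scale submodule_dom.
  move=> x y Ax By /=; rewrite mulrACA; apply: dom_mul; [exact: dA | exact: eB].
Qed.

Lemma ideal_colon A B : ideal D A -> ideal D B -> ideal D (colon A B).
Proof.
move=> [smA [a Aa a0] [d [Dd d0 dA]]] [smB [b Bb b0] [e [De e0 eB]]]; split.
- exact: submodule_colon.
- exists (a * e); last by rewrite mulf_neq0.
  by move=> y By; rewrite -mulrA mulrC; case: smA => _ _; apply; [apply: eB|].
(* The denominator comes from one nonzero [b = p / q] in [B]: as [x * b] lies in [A], multiplying
   [x] by [d * p = q * d * b] lands in [D]. *)
- have [p [q [Dp Dq q0 def_b]]] := dom_frac b.
  have p0 : p != 0 by apply: contraNneq b0 => p0; rewrite def_b p0 mul0r.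
  exists (d * p); split; [exact: dom_mul | by rewrite mulf_neq0 |] => x ABx.
  have -> : d * p * x = q * (d * (x * b)) by rewrite def_b; field.
  by apply: dom_mul => //; apply: dA; apply: ABx.
Qed.

Lemma sub_t_closure I : I `<=` t_closure D I.
Proof.
move=> x Ix; exists [:: x] => [g|y Dy]; first by rewrite inE => /eqP->.
by rewrite mulrC; apply: Dy; rewrite inE.
Qed.

Lemma t_closure_mono I J : I `<=` J -> t_closure D I `<=` t_closure D J.
Proof. by move=> IJ x [s sI Ds]; exists s => // g /sI/IJ. Qed.

(** Each entry of a finite witness list has its own finite witness list in [I]; their concatenation
    is a witness over [I]. *)
Lemma t_closure_id I : t_closure D (t_closure D I) `<=` t_closure D I.
Proof.
move=> x [s sI Ds].
suff [t tI Dt] : exists2 t : seq K, (forall g, g \in t -> I g) &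
    forall y, (forall g, g \in t -> D (y * g)) ->
    forall g, g \in s -> D (y * g).
  by exists t => // y /Dt /Ds.
elim: s sI {Ds} => [|g s IHs] sI; first by exists [::].
have [|t tI Dt] := IHs; first by move=> h hs; apply: sI; rewrite inE hs orbT.
have [u uI Du] : t_closure D I g by apply: sI; rewrite inE eqxx.
exists (u ++ t); first exact: mem_cat_all.
move=> y Dy h; rewrite inE => /predU1P[->|hs].
  by rewrite mulrC; apply: Du => k ku; apply: Dy; rewrite mem_cat ku.
by apply: Dt => // k kt; apply: Dy; rewrite mem_cat kt orbT.
Qed.

Lemma t_closure_sub I J : I `<=` t_closure D J -> t_closure D I `<=` t_closure D J.
Proof.
by move=> IJ; apply: subset_trans (@t_closure_id J); apply: t_closure_mono.
Qed.

(** Scaling the witness list by [c] avoids any division by [c]. This is the means of pushing a fixed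
    multiplier through the closure. *)
Lemma t_closure_scale c I x :
  t_closure D [set y | I (c * y)] x -> t_closure D I (c * x).
Proof.
move=> [s sI Ds]; exists [seq c * g | g <- s] => [_ /mapP[g /sI ? ->] //|y Dy].
rewrite -mulrA mulrCA; apply: Ds => g gs.
by rewrite -mulrA mulrCA; apply/Dy/map_f.
Qed.

Lemma submodule_t_closure I : submodule D (t_closure D I).
Proof.
split.
- by exists [::] => // y _; rewrite mul0r; apply: dom0.
- move=> x y [s sI Ds] [t tI Dt]; exists (s ++ t); first exact: mem_cat_all.
  move=> z Dz; rewrite mulrDl.
  by apply: dom_add; [apply: Ds | apply: Dt] => g gs; apply: Dz;
    rewrite mem_cat gs ?orbT.
- move=> r x Dr [s sI Ds]; exists s => // y Dy; rewrite -mulrA.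
  by apply: dom_mul => //; apply: Ds.
Qed.

Lemma t_closure_dom : t_closure D D `<=` D.
Proof.
move=> x [s sD Ds]; rewrite -[x]mulr1; apply: Ds => g /sD.
by rewrite mul1r.
Qed.

Lemma ideal_t_closure I : ideal D I -> ideal D (t_closure D I).
Proof.
move=> [smI [x Ix x0] [d [Dd d0 dI]]]; split; first exact: submodule_t_closure.
  by exists x => //; apply: sub_t_closure.
exists d; split => // y Iy; apply: t_closure_dom.
by apply: t_closure_scale; apply: t_closure_mono Iy => z; apply: dI.
Qed.

Lemma t_closure_colon A B : t_closure D A `<=` A ->
  t_closure D (colon A B) `<=` colon A B.
Proof.
move=> clA x xAB b Bb; rewrite mulrC; apply: clA.
apply: t_closure_scale; apply: t_closure_mono xAB => y /(_ _ Bb).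
by rewrite mulrC.
Qed.

(** A finite list and the module it spans have the same colon into [D]. *)
Lemma t_opE I : ideal D I -> t_op D I = t_closure D I.
Proof.
move=> [smI [z Iz z0] denI]; apply/seteqP; split=> x.
  move=> [J [idJ [n [g defJ]] JI Jx]]; exists (codom g).
    move=> _ /codomP[i ->]; apply: JI; rewrite defJ.
    exists (fun j => (j == i)%:R); split.
      by move=> j; case: eqP => _; [exact: dom1 | exact: dom0].
    rewrite (bigD1 i) //= eqxx mul1r big1 ?addr0 // => j /negPf->.
    by rewrite mul0r.
  move=> y Dy; apply: Jx => w; rewrite defJ => -[a [Da ->]].
  rewrite mulr_sumr; apply: submodule_sum submodule_dom _ => i.
  by rewrite mulrCA; apply: dom_mul => //; apply/Dy/codom_f.
(* The nonzero [z] is put in front so that the span is a nonzero ideal even if [s] is empty or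
   consists of zeros. *)
move=> [s sI Ds]; pose g (i : 'I_(size (z :: s))) := (z :: s)`_i.
have gI i : I (g i).
  have := mem_nth 0 (ltn_ord i); rewrite inE => /predU1P[gz|/sI //].
  by rewrite /g gz.
have spanI : span_of D g `<=` I.
  move=> _ [a [Da ->]]; apply: submodule_sum => // i.
  by case: smI => _ _; apply.
have g_span i : span_of D g (g i).
  exists (fun j => (j == i)%:R); split.
    by move=> j; case: eqP => _; [exact: dom1 | exact: dom0].
  rewrite (bigD1 i) //= eqxx mul1r big1 ?addr0 // => j /negPf->.
  by rewrite mul0r.
exists (span_of D g); split=> //; last 2 first.
- by exists (size (z :: s)), g.
- move=> y Dy; apply: Ds => h hs.
  have lt_h : (index h (z :: s) < size (z :: s))%N by rewrite index_mem inE hs orbT.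
  suff -> : h = g (Ordinal lt_h) by apply/Dy/g_span.
  by rewrite /g nth_index // inE hs orbT.
split.
- split.
  + exists (fun=> 0); split; first by move=> _; exact: dom0.
    by rewrite big1 // => i _; rewrite mul0r.
  + move=> _ _ [a [Da ->]] [b [Db ->]]; exists (fun i => a i + b i); split.
      by move=> i; apply: dom_add.
    by rewrite -big_split; apply: eq_bigr => i _ /=; rewrite mulrDl.
  + move=> r _ Dr [a [Da ->]]; exists (fun i => r * a i); split.
      by move=> i; apply: dom_mul.
    by rewrite mulr_sumr; apply: eq_bigr => i _; rewrite mulrA.
- by exists z => //; exact: (g_span ord0).
- by have [d [Dd d0 dI]] := denI; exists d; split=> // y /spanI /dI.
Qed.

End Closure.

(** * Localization at a prime *)

Lemma clifford_t_regular_closure {K : fieldType} {D : set K} :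
  fraction_domain D ->
  clifford_t_regular D <->
  (forall I, ideal D I -> exists2 J, ideal D J &
     t_closure D I = t_closure D (ideal_mul (ideal_mul I I) J)).
Proof.
move=> domD; split=> cliff I idI; have [J idJ eqI] := cliff I idI; exists J => //.
  by rewrite -!(t_opE domD) //; do 2!apply: ideal_mul_ideal => //.
by rewrite !(t_opE domD) //; do 2!apply: ideal_mul_ideal => //.
Qed.

Lemma t_stable_closure {K : fieldType} {D : set K} :
  fraction_domain D ->
  t_stable D <->
  (forall I, ideal D I -> let L := t_closure D I in let E := colon L L in
     t_closure D (ideal_mul L (colon E L)) = E).
Proof.
move=> domD.
suff idLG I : ideal D I -> let L := t_closure D I in let E := colon L L in
    ideal D (ideal_mul L (colon E L)).
  split=> stab I idI; have := stab I idI; rewrite /= (t_opE domD idI) t_opE //;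
  exact: idLG.
move=> idI L E; have idL : ideal D L by apply: ideal_t_closure.
by apply: ideal_mul_ideal => //; do 2!apply: ideal_colon => //.
Qed.

Section Localization.
Context {K : fieldType} {D M : set K}.
Hypotheses (domD : fraction_domain D) (primeM : prime_ideal D M).
Implicit Types A B I J : set K.
Notation locM := (loc D M).
Notation D_M := (loc D M D).

Lemma prime_submodule : submodule D M. Proof. by case: primeM => -[]. Qed.

Lemma prime_not1 : ~ M 1.
Proof.
case: primeM => _ MD neqMD _ M1; apply: neqMD; apply/seteqP; split=> // x Dx.
by rewrite -[x]mulr1; case: prime_submodule => _ _; apply.
Qed.

Lemma prime_notM {a b} : D a -> D b -> ~ M a -> ~ M b -> ~ M (a * b).
Proof. by case: primeM => _ _ _ pM Da Db Ma Mb /pM[]. Qed.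

Lemma prime_neq0 {a} : ~ M a -> a != 0.
Proof.
by move=> Ma; apply/eqP => a0; apply: Ma; rewrite a0; case: prime_submodule.
Qed.

Lemma sub_loc A : A `<=` locM A.
Proof.
move=> x Ax; exists 1; rewrite mul1r.
by split=> //; [exact: dom1 | exact: prime_not1].
Qed.

Lemma loc_mono A B : A `<=` B -> locM A `<=` locM B.
Proof. by move=> AB x [s [Ds Ms /AB]]; exists s. Qed.

Lemma loc_add A x y : submodule D A -> locM A x -> locM A y -> locM A (x + y).
Proof.
move=> [_ AD AZ] [s [Ds Ms Asx]] [t [Dt Mt Aty]]; exists (s * t).
split; [exact: dom_mul | exact: prime_notM |].
by rewrite mulrDr; apply: AD; [rewrite mulrAC mulrC | rewrite -mulrA]; apply: AZ.
Qed.

Lemma loc_mul A x y : submodule D A -> D_M x -> locM A y -> locM A (x * y).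
Proof.
move=> [_ _ AZ] [s [Ds Ms Asx]] [t [Dt Mt Aty]]; exists (s * t).
split; [exact: dom_mul | exact: prime_notM |].
by rewrite mulrACA; apply: AZ.
Qed.

Lemma submodule_loc A : submodule D A -> submodule D_M (locM A).
Proof.
move=> smA; split; first by apply: sub_loc; case: smA.
  by move=> x y; apply: loc_add.
by move=> x y; apply: loc_mul.
Qed.

Lemma loc_submodule A : submodule D_M A -> submodule D A.
Proof. by move=> [A0 AD AZ]; split=> // a x Da; apply: AZ; apply: sub_loc. Qed.

Lemma loc_inv s : D s -> ~ M s -> D_M s^-1.
Proof.
move=> Ds Ms; exists s; split=> //; rewrite mulfV; [exact: dom1 | exact: prime_neq0].
Qed.

Lemma loc_loc A : submodule D_M A -> locM A `<=` A.
Proof.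
move=> [_ _ AZ] x [s [Ds Ms Asx]].
by rewrite -(mulKf (prime_neq0 Ms) x); apply: AZ => //; apply: loc_inv.
Qed.

Lemma fraction_domain_loc : fraction_domain D_M.
Proof.
have smD := submodule_dom domD; split.
- by apply: sub_loc; apply: dom1.
- move=> x y Dx Dy; apply: loc_add => //; rewrite -mulN1r; apply: loc_mul => //.
  by apply: sub_loc; apply: dom_opp => //; apply: dom1.
- by move=> x y; apply: loc_mul.
- move=> x; have [a [b [Da Db b0 ->]]] := dom_frac domD x.
  by exists a, b; split=> //; apply: sub_loc.
Qed.

Lemma localizationE : localization D M = D_M.
Proof.
apply/seteqP; split=> [_ [a [s [Da Ds Ms ->]]] | x [s [Ds Ms Dsx]]].
  by exists s; split=> //; rewrite mulrCA divff ?mulr1 // prime_neq0.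
by exists (s * x), s; split=> //; rewrite mulrC mulKf // prime_neq0.
Qed.

Lemma ideal_loc A : ideal D A -> ideal D_M (locM A).
Proof.
move=> [smA [x Ax x0] [d [Dd d0 dA]]]; split; first exact: submodule_loc.
  by exists x => //; apply: sub_loc.
exists d; split=> //; first exact: sub_loc.
by move=> y [s [Ds Ms Asy]]; exists s; split=> //; rewrite mulrCA; apply: dA.
Qed.

Lemma loc_common_den A (s : seq K) : submodule D A ->
  (forall g, g \in s -> locM A g) ->
  exists u, [/\ D u, ~ M u & forall g, g \in s -> A (u * g)].
Proof.
move=> [_ _ AZ]; elim: s => [|h s IHs] sA.
  by exists 1; split=> //; [exact: dom1 | exact: prime_not1].
have [|u [Du Mu uA]] := IHs; first by move=> g gs; apply: sA; rewrite inE gs orbT.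
have [v [Dv Mv vA]] : locM A h by apply: sA; rewrite inE eqxx.
exists (u * v); split; [exact: dom_mul | exact: prime_notM |].
move=> g; rewrite inE => /predU1P[->|gs]; first by rewrite -mulrA; apply: AZ.
by rewrite mulrAC mulrC; apply: AZ => //; apply: uA.
Qed.

(** A witness involves finitely many elements of [locM A], so one denominator outside [M] clears
    them all. *)
Lemma t_closure_loc A : submodule D A ->
  t_closure D (locM A) `<=` locM (t_closure D A).
Proof.
move=> smA x [s sA Ds]; have [u [Du Mu uA]] := loc_common_den smA sA.
by exists u; split=> //; apply: t_closure_scale; exists s.
Qed.

(** If [y] multiplies the witness list into D_M, then [u * y] multiplies it into [D] for some [u]
    outside [M], whence [u * y * x] is in [D]. *)
Lemma t_closure_sub_local A : t_closure D A `<=` t_closure D_M A.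
Proof.
move=> x [s sA Ds]; exists s => // y sDM.
have [|u [Du Mu uD]] :=
  loc_common_den (s := [seq y * g | g <- s]) (submodule_dom domD).
  by move=> _ /mapP[g gs ->]; apply: sDM.
exists u; split=> //; rewrite mulrCA; apply: Ds => g gs.
by rewrite -mulrA; apply/uD/map_f.
Qed.

Lemma loc_contraction I : ideal D_M I ->
  exists A, [/\ ideal D A, A `<=` I & I `<=` locM A].
Proof.
move=> [smI [x Ix x0] [d [Dd d0 dI]]]; have smID := loc_submodule smI.
have {Dd} [s [Ds Ms Dsd]] := Dd; set e := s * d in Dsd.
have e0 : e != 0 by rewrite mulf_neq0 // prime_neq0.
(* [I] need not lie in D_M, so it is cut down by the multiples of [e^-1] rather than by [D].
   Localizing recovers all of [I] because [e] multiplies [I] into D_M. *)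
pose A := I `&` [set y | D (e * y)].
have IA : I `<=` locM A.
  move=> y Iy; have [u [Du Mu Dudy]] := dI _ Iy; exists u; split=> //; split.
    by case: smID => _ _; apply.
  by rewrite /= /e -mulrA (mulrCA d); apply: dom_mul.
exists A; split=> //; last by move=> y [].
split; first by apply: submoduleI => //; apply: submodule_scale; apply: submodule_dom.
  have [u [Du Mu Aux]] := IA _ Ix; exists (u * x) => //.
  by rewrite mulf_neq0 // prime_neq0.
by exists e; split=> // y [].
Qed.

Lemma clifford_t_regular_loc : clifford_t_regular D -> clifford_t_regular D_M.
Proof.
have domDM := fraction_domain_loc.
move=> /(clifford_t_regular_closure domD) cliff.
apply/(clifford_t_regular_closure domDM) => I idI.
have [A [idA AI IA]] := loc_contraction idI.
have smI := ideal_submodule idI; have smI' := loc_submodule smI.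
have [J idJ eqA] := cliff A idA; exists (locM J); first exact: ideal_loc.
apply/seteqP; split; apply: t_closure_sub.
  (* An element of [I] has a multiple, by a denominator outside [M], in [A] and hence in (A^2 J)^t;
     this [D]-closure lies in the D_M-closure. The other inclusion clears the denominators of all
     three factors and uses [eqA] backwards. *)
  move=> x /IA locAx; apply: (loc_loc (submodule_t_closure domDM _)).
  move: x locAx; apply: loc_mono => y /(sub_t_closure (D := D)); rewrite eqA.
  move=> /t_closure_sub_local; apply: t_closure_mono.
  apply: (ideal_mul3_sub (submodule_mul _ (submodule_mul _ smI'))).
  move=> a b j /AI Ia /AI Ib Jj; apply: mem_ideal_mul; last exact: sub_loc.
  exact: mem_ideal_mul.
have smT := submodule_t_closure domDM I.
apply: (ideal_mul3_sub smT) => a b j.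
move=> /IA[v [Dv Mv Ava]] /IA[w [Dw Mw Awb]] [u [Du Mu Juj]].
apply: (loc_loc smT); exists (v * w * u); split.
- by do 2!apply: dom_mul => //.
- by do 2?apply: prime_notM => //; apply: dom_mul.
- rewrite mulrACA (mulrACA v); apply: t_closure_mono AI _ _.
  apply: t_closure_sub_local; rewrite eqA; apply: sub_t_closure.
  by do 2!apply: mem_ideal_mul => //.
Qed.

Lemma t_stable_loc : t_stable D -> t_stable D_M.
Proof.
have domDM := fraction_domain_loc.
move=> /(t_stable_closure domD) stab.
apply/(t_stable_closure domDM) => I idI; set H := t_closure D_M I; set E' := colon H H.
have smH : submodule D_M H by apply: submodule_t_closure.
(* Contracting the closure [H] rather than [I] yields that [L] lies in [H] and [H] in [locM L]. *)
have [A [idA AH HA]] := loc_contraction (ideal_t_closure domDM idI).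
have := stab A idA; set L := t_closure D A; set E := colon L L => /= eqE.
have LH : L `<=` H.
  by move=> x /t_closure_sub_local; apply: t_closure_sub.
have HL : H `<=` locM L by move=> x /HA; apply: loc_mono; apply: sub_t_closure.
apply/seteqP; split.
  apply: subset_trans (@t_closure_colon _ _ _ _ (@t_closure_id _ _ _)).
  apply: t_closure_mono; apply: (ideal_mul_sub (submodule_colon _ smH)).
  by move=> h g Hh G'g; rewrite mulrC; apply: G'g.
(* It suffices to use that 1 lies in [E], the t-closure of L (E : L): the factor [e] sends [L] into
   [H], and (E : L) is contained in (E' : H). *)
move=> e E'e; rewrite -[e]mulr1; apply: t_closure_scale.
have /t_closure_sub_local : t_closure D (ideal_mul L (colon E L)) 1.
  by rewrite eqE => l; rewrite mul1r.
apply: t_closure_mono; apply: (ideal_mul_sub (submodule_scale _ (submodule_mul _ smH))).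
move=> l g Ll Gg /=; rewrite mulrA; apply: mem_ideal_mul.
  by apply: E'e; apply: LH.
move=> h Hh h' Hh'; apply: (loc_loc smH).
have [v [Dv Mv Lvh]] := HL _ Hh; have [w [Dw Mw Lwh]] := HL _ Hh'.
exists (v * w); split; [exact: dom_mul | exact: prime_notM | apply: LH].
by rewrite (_ : _ * _ = g * (v * h) * (w * h')); [apply: Gg | ring].
Qed.

End Localization.

(** The ideal (E : L) serves as [J]: 1 lies in the t-closure of L (E : L), and multiplying by an
    element of [I] gives one inclusion; the other holds because (E : L) multiplies [L] into [E]. *)
Lemma t_stable_clifford {K : fieldType} {D : set K} :
  fraction_domain D -> t_stable D -> clifford_t_regular D.
Proof.
move=> domD /(t_stable_closure domD) stab.
apply/(clifford_t_regular_closure domD) => I idI.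
have := stab I idI; set L := t_closure D I; set E := colon L L => /= eqE.
have idL : ideal D L by apply: ideal_t_closure.
exists (colon E L); first by apply: ideal_colon => //; apply: ideal_colon.
have smX X : submodule D (t_closure D X) by apply: submodule_t_closure.
apply/seteqP; split; apply: t_closure_sub.
  move=> i Ii; rewrite -[i]mulr1; apply: t_closure_scale.
  have : t_closure D (ideal_mul L (colon E L)) 1 by rewrite eqE => l; rewrite mul1r.
  apply: t_closure_sub; apply: (ideal_mul_sub (D := D)).
    exact: submodule_t_closure.
  move=> l g Ll Gg; rewrite mulrC; apply: t_closure_scale.
  apply: t_closure_mono Ll => j Ij /=; rewrite (mulrC g) mulrA.
  by do 2!apply: mem_ideal_mul => //.
apply: (ideal_mul3_sub (smX I)) => a b g Ia Ib Gg; rewrite mulrC mulrA.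
by apply: Gg; apply: sub_t_closure.
Qed.

(** * t-maximal ideals *)

(** The set [S] is a parameter so that one maximality argument covers both t-maximal ideals, where
    [S] is the singleton of 1, and t-primes disjoint from a larger multiplicative set. *)
Definition t_ideal_avoiding {K : fieldType} (D S P : set K) : Prop :=
  [/\ ideal D P, P `<=` D, t_closure D P `<=` P & forall s, S s -> ~ P s].

Section TMaximal.
Context {K : fieldType} {D : set K}.
Hypothesis domD : fraction_domain D.
Implicit Types A B I J M N P S : set K.

Lemma integral_ideal A : submodule D A -> A `<=` D ->
  (exists2 x, A x & x != 0) -> ideal D A.
Proof.
move=> smA AD A0; split=> //; exists 1.
by split=> [||x /AD]; [exact: dom1 | exact: oner_neq0 | rewrite mul1r].
Qed.

(** The set of all [x] with [P (c * x)] is t-closed and contains both [d] and [P]. *)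
Lemma t_closure_setU1_sub P c d : t_closure D P `<=` P -> submodule D P ->
  P (c * d) -> D c -> forall x, t_closure D (d |` P) x -> P (c * x).
Proof.
move=> clP [_ _ PZ] Pcd Dc x xPd; apply/clP/t_closure_scale.
by apply: t_closure_mono xPd => y [-> //|Py]; apply: PZ.
Qed.

(** If [a] and [b] lie outside [P], the t-closures of [P] enlarged by [a] and by [b] meet [S], in
    [s] and [t] say. From [a * b] in [P] one passes to [s * b] and then to [s * t] in [P], which is
    impossible. *)
Lemma maximal_avoiding_prime S P : S 1 -> (forall s t, S s -> S t -> S (s * t)) ->
  t_ideal_avoiding D S P ->
  (forall B, t_ideal_avoiding D S B -> P `<=` B -> B = P) -> prime_ideal D P.
Proof.
move=> S1 SM [idP PD clP SP] maxP; split=> //.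
  by move=> PeqD; apply: (SP 1) => //; rewrite PeqD; exact: dom1.
have meet c : D c -> ~ P c -> exists2 s, S s & t_closure D (c |` P) s.
  move=> Dc Pc; apply: contrapT => disj.
  have sub_cP : c |` P `<=` t_closure D (c |` P) by exact: sub_t_closure.
  have cPD : t_closure D (c |` P) `<=` D.
    apply: subset_trans (t_closure_dom (D := D)); apply: t_closure_mono.
    by move=> x [->|/PD].
  suff eqP : t_closure D (c |` P) = P by apply: Pc; rewrite -eqP; apply: sub_cP; left.
  apply: maxP; last by move=> x Px; apply: sub_cP; right.
  split=> //; [|exact: t_closure_id | by move=> s Ss ?; apply: disj; exists s].
  apply: integral_ideal => //; first exact: submodule_t_closure.
  by have [x Px x0] := ideal_neq0 idP; exists x => //; apply: sub_cP; right.
move=> a b Da Db Pab; apply: contrapT => /not_orP[].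
move=> /(meet _ Da)[s Ss Ps] /(meet _ Db)[t St Pt].
have smP := ideal_submodule idP.
have Psb : P (s * b).
  by rewrite mulrC; apply: (t_closure_setU1_sub clP smP _ Db Ps); rewrite mulrC.
apply: (SP (s * t)); first exact: SM.
apply: (t_closure_setU1_sub clP smP Psb _ Pt).
apply: t_closure_dom; apply: t_closure_mono Ps => x [->//|/PD //].
Qed.

Lemma exists_maximal_avoiding S A : t_ideal_avoiding D S A ->
  exists P, [/\ t_ideal_avoiding D S P, A `<=` P &
    forall B, t_ideal_avoiding D S B -> P `<=` B -> B = P].
Proof.
move=> tA; pose good X := t_ideal_avoiding D S X /\ A `<=` X.
have A0 : A !=set0 by case: tA => -[[? _ _] _ _] _ _ _; exists 0.
have [|P [goodP maxP]] := @Zorn_bigcup K [set X | X = set0 \/ good X].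
  move=> F goodF totF.
  have [noG|/existsNP[X0 /not_implyP[FX0 X00]]] := pselect (forall X, F X -> X = set0).
    by left; apply/seteqP; split=> // x [X /noG ->].
  have memG X x : F X -> X x -> good X.
    by move=> FX Xx; case: (goodF _ FX) => // X_0; move: Xx; rewrite X_0.
  have goodX0 : good X0 by case: (goodF _ FX0).
  right; set U := \bigcup_(X in F) X.
  have UD : U `<=` D.
    by move=> x [X FX Xx]; have [[_ XD _ _] _] := memG _ _ FX Xx; apply: XD.
  (* A finite subset of the union lies in one member of the chain. Since closure witnesses are
     finite, this makes the union t-closed. *)
  have seqU (s : seq K) : (forall g, g \in s -> U g) ->
      exists2 X, F X /\ good X & forall g, g \in s -> X g.
    elim: s => [|h s IHs] sU; first by exists X0.
    have [|X [FX gX] sX] := IHs; first by move=> g gs; apply: sU; rewrite inE gs orbT.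
    have [Y FY Yh] : U h by apply: sU; rewrite inE eqxx.
    have [XY|YX] := totF _ _ FX FY.
      exists Y; first by split=> //; apply: memG Yh.
      by move=> g; rewrite inE => /predU1P[->//|/sX/XY].
    by exists X => // g; rewrite inE => /predU1P[->|/sX//]; apply: YX.
  have AU : A `<=` U by case: goodX0 => _ AX x /AX X0x; exists X0.
  split=> //; split=> //.
  - apply: integral_ideal => //; last first.
      case: tA => idA _ _ _; have [x Ax x0] := ideal_neq0 idA.
      by exists x => //; apply: AU.
    split.
    + by apply: AU; case: tA => -[[]].
    + move=> x y Ux Uy; have [|X [FX [[[[_ XA _] _ _] _ _ _] _]] sX] := seqU [:: x; y].
        by move=> g; rewrite !inE => /orP[] /eqP->.
      by exists X => //; apply: XA; apply: sX; rewrite !inE eqxx ?orbT.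
    + move=> a x Da [X FX Xx]; have [[[[_ _ XZ] _ _] _ _ _] _] := memG _ _ FX Xx.
      by exists X => //; apply: XZ.
  - move=> x [s sU Ds]; have [X [FX [[_ _ clX _] _]] sX] := seqU s sU.
    by exists X => //; apply: clX; exists s.
  - move=> s Ss [X FX Xs]; have [[_ _ _ XS] _] := memG _ _ FX Xs.
    exact: XS Ss Xs.
have {}goodP : good P.
  case: goodP => // P0; exfalso; apply: (maxP A); last by right; split.
  rewrite P0; split; first by move=> x [].
  by case: A0 => x Ax /(_ _ Ax).
exists P; split; [by case: goodP | by case: goodP |] => B tB PB.
apply: contrapT => neqBP; apply: (maxP B).
  by split=> // BP; apply: neqBP; apply/seteqP.
by right; split=> //; apply: subset_trans PB; case: goodP.
Qed.

Lemma proper_integral_t_idealP I :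
  proper_integral_t_ideal D I <-> t_ideal_avoiding D [set 1] I.
Proof.
split=> [[[idI eqI] ID neqI]|[idI ID clI I1]].
  split=> // [|_ -> I1]; first by rewrite {2}eqI t_opE.
  apply: neqI; apply/seteqP; split=> // x Dx; rewrite -[x]mulr1.
  by have [_ _] := ideal_submodule idI; apply.
split=> //; last by move=> IeqD; apply: (I1 1) => //; rewrite IeqD; apply: dom1.
split=> //; rewrite t_opE //; apply/seteqP; split=> //; exact: sub_t_closure.
Qed.

Lemma t_maximal_closed M : t_maximal D M -> t_closure D M `<=` M.
Proof. by case=> /proper_integral_t_idealP[]. Qed.

Lemma t_maximal_prime M : t_maximal D M -> prime_ideal D M.
Proof.
move=> [/proper_integral_t_idealP tM maxM].
apply: (@maximal_avoiding_prime [set 1]) => // [s t -> ->|B]; first by rewrite /= mulr1.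
by move/proper_integral_t_idealP; exact: maxM.
Qed.

Lemma sub_t_maximal A : ideal D A -> A `<=` D -> t_closure D A `<=` A -> ~ A 1 ->
  exists2 M, t_maximal D M & A `<=` M.
Proof.
move=> idA AD clA A1; have [|P [tP AP maxP]] := @exists_maximal_avoiding [set 1] A.
  by split=> // _ ->.
exists P => //; split; first exact/proper_integral_t_idealP.
by move=> B /proper_integral_t_idealP; apply: maxP.
Qed.

(** A t-ideal is the intersection of its localizations: the conductor [C] of [y] into [A] is an
    integral t-ideal contained in no t-maximal ideal, so it contains 1. *)
Lemma t_local_global A y : ideal D A -> t_closure D A `<=` A ->
  (forall M, t_maximal D M -> loc D M A y) -> A y.
Proof.
move=> idA clA Ay; have smA := ideal_submodule idA.
pose C := D `&` [set r | A (y * r)].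
have [p [q [Dp Dq q0 def_y]]] := dom_frac domD y.
have [a Aa a0] := ideal_neq0 idA.
have [p' [q' [Dp' Dq' q'0 def_a]]] := dom_frac domD a.
have p'0 : p' != 0 by apply: contraNneq a0 => p'0; rewrite def_a p'0 mul0r.
have AZ : forall r x, D r -> A x -> A (r * x) by case: smA.
suff [] : C 1 by rewrite /= mulr1.
apply: contrapT => C1; have [] := @sub_t_maximal C _ _ _ C1.
- apply: integral_ideal; last 1 first.
  + exists (q * p'); last by rewrite mulf_neq0.
    split; first exact: dom_mul.
    rewrite /=; have -> : y * (q * p') = p * q' * a.
      by rewrite def_y def_a; field; apply/andP.
    by apply: AZ => //; apply: dom_mul.
  + apply: submoduleI; first exact: submodule_dom.
    exact: submodule_scale.
  + by move=> x [].
- by move=> x [].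
- move=> x Cx; split; first by apply: t_closure_dom; apply: t_closure_mono Cx => z [].
  by apply: clA; apply: t_closure_scale; apply: t_closure_mono Cx => z [].
- move=> M tM CM; have [s [Ds Ms Asy]] := Ay M tM.
  by apply: Ms; apply: CM; split=> //; rewrite /= mulrC.
Qed.

End TMaximal.

(** * Independence of t-maximal ideals *)

Section Independence.
Context {K : fieldType} {D : set K}.
Hypothesis domD : fraction_domain D.
Hypothesis t_primeP : forall P : set K, t_prime D P ->
  exists! M : set K, t_maximal D M /\ P `<=` M.
Implicit Types A B I J M N P S : set K.

(* Otherwise a t-ideal containing a numerator and maximal for being disjoint
   from the products [a * b] with [a] outside [M] and [b] outside [N] would be
   a t-prime contained in both [M] and [N]. *)
Lemma t_maximal_independent M N c : t_maximal D M -> t_maximal D N -> M <> N ->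
  exists s, [/\ D s, ~ M s & loc D N D (s * c)].
Proof.
move=> tM tN neqMN.
have pM := t_maximal_prime domD tM; have pN := t_maximal_prime domD tN.
(* Writing [c = q / p], it is enough that [p] divides some [a * b] with [a] outside [M] and [b]
   outside [N]: then [b] multiplies [a * c] into [D]. *)
suff ind x : D x -> x != 0 ->
    exists a b, [/\ D a, D b, ~ M a, ~ N b & D (x^-1 * (a * b))].
  have [->|c0] := eqVneq c 0.
    exists 1; rewrite mulr0; split; [exact: dom1 | exact: (prime_not1 pM) |].
    by apply: sub_loc => //; apply: dom0.
  have [p [q [Dp Dq q0 def_c]]] := dom_frac domD c^-1.
  have p0 : p != 0.
    by apply: contraNneq c0 => p0; rewrite -invr_eq0 def_c p0 mul0r.
  have [a [b [Da Db Ma Nb Dab]]] := ind p Dp p0; exists a; split=> //.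
  exists b; split=> //; rewrite -[c]invrK def_c.
  have -> : b * (a * (p / q)^-1) = q * (p^-1 * (a * b)) by field; apply/andP.
  exact: dom_mul.
move=> Dx x0; apply: contrapT => disj.
pose S := [set s | exists a b, [/\ D a, D b, ~ M a, ~ N b & s = a * b]].
have M1 := prime_not1 pM; have N1 := prime_not1 pN; have D1 := dom1 domD.
have S1 : S 1 by exists 1, 1; rewrite mulr1.
have SM s t : S s -> S t -> S (s * t).
  move=> [a [b [Da Db Ma Nb ->]]] [a' [b' [Da' Db' Ma' Nb' ->]]].
  exists (a * a'), (b * b'); split; last exact: mulrACA.
  - exact: dom_mul.
  - exact: dom_mul.
  - exact: (prime_notM pM).
  - exact: (prime_notM pN).
pose A := [set y | D (x^-1 * y)].
have AD : A `<=` D by move=> y /(dom_mul domD Dx); rewrite mulVKf.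
have [|P [tP _ maxP]] := @exists_maximal_avoiding _ _ domD S A.
  split=> //.
  - apply: integral_ideal => //; first exact: submodule_scale (submodule_dom domD).
    by exists x => //; rewrite /A /= mulVf.
  - by move=> y /t_closure_scale /t_closure_dom.
  - by move=> s [a [b [Da Db Ma Nb ->]]] Dab; apply: disj; exists a, b.
have [idP PD clP SP] := tP.
have pP : prime_ideal D P by apply: maximal_avoiding_prime tP maxP.
have [|M0 [_ uniqM0]] := t_primeP (P := P).
  split=> //; split=> //; rewrite t_opE //; apply/seteqP.
  by split=> //; exact: sub_t_closure.
have PM : P `<=` M.
  move=> z Pz; apply: contrapT => Mz; apply: (SP z) => //; exists z, 1.
  by rewrite mulr1; split=> //; apply: PD.
have PN : P `<=` N.
  move=> z Pz; apply: contrapT => Nz; apply: (SP z) => //; exists 1, z.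
  by rewrite mul1r; split=> //; apply: PD.
by apply: neqMN; rewrite -(uniqM0 M) ?(uniqM0 N).
Qed.

Lemma clifford_t_finite_character : clifford_t_regular D -> t_finite_character D.
Proof.
move=> /(clifford_t_regular_closure domD) cliff x Dx x0.
have smD := submodule_dom domD.
pose Q M := D `&` [set y | loc D M D (x^-1 * y)].
pose B M := D `&` [set y | forall q, Q M q -> D (x^-1 * (y * q))].
(* Independence gives [s] in [Q M] outside [N]; then [y * s] lies in x D, hence in [N], which forces
   [y] into [N]. *)
have BN M N y : t_maximal D M -> t_maximal D N -> M <> N -> B M y -> N x -> N y.
  move=> tM tN neqMN [Dy By] Nx; have pN := t_maximal_prime domD tN.
  have [s [Ds Ns Msx]] := t_maximal_independent x^-1 tN tM (nesym neqMN).
  have Qs : Q M s by split=> //; rewrite /= mulrC.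
  have Nys : N (y * s).
    rewrite -(mulVKf x0 (y * s)) mulrC; have [_ _] := prime_submodule pN.
    by apply=> //; apply: By.
  by have [_ _ _ /(_ y s Dy Ds Nys)[]] := pN.
have BM M : t_maximal D M -> M x -> ~ B M `<=` M.
  move=> tM Mx BsubM; have pM := t_maximal_prime domD tM.
  have smM := prime_submodule pM.
  have QD : Q M `<=` D by move=> y [].
  have Qx : Q M x.
    by split=> //; rewrite /= mulVf //; apply: sub_loc => //; apply: dom1.
  have idQ : ideal D (Q M).
    apply: integral_ideal => //; last by exists x.
    apply: submoduleI => //; apply: submodule_scale.
    by apply: (loc_submodule domD pM); apply: submodule_loc.
  have clQ : t_closure D (Q M) `<=` Q M.
    move=> y Qy; split; first by apply: t_closure_dom; apply: t_closure_mono Qy.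
    suff : loc D M (t_closure D D) (x^-1 * y) by apply: loc_mono; apply: t_closure_dom.
    apply: (t_closure_loc domD pM smD); apply: t_closure_scale.
    by apply: t_closure_mono Qy => z [].
  have [J idJ eqQ] := cliff _ idQ.
  have QQJ q q' j : Q M q -> Q M q' -> J j -> Q M (q * q' * j).
    move=> Qq Qq' Jj; apply: clQ; rewrite eqQ; apply: sub_t_closure.
    by do 2!apply: mem_ideal_mul => //.
  (* Checked locally. At [M], the product [x * q * j] lies in x D_M and [x] cancels; at another [N],
     independence provides an [s] in [Q M] outside [N], and [s * q * j] lies in [Q M]. *)
  have QJD q j : Q M q -> J j -> D (q * j).
    move=> Qq Jj; apply: (t_local_global domD (ideal_dom domD)).
      exact: t_closure_dom.
    move=> N tN; have pN := t_maximal_prime domD tN.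
    have [->|neqMN] := pselect (N = M).
      by have [_ /=] := QQJ x q j Qx Qq Jj; rewrite -mulrA mulKf.
    have [s [Ds Ns Msx]] := t_maximal_independent x^-1 tN tM neqMN.
    exists s; split=> //; rewrite mulrA; apply: QD; apply: QQJ => //.
    by split=> //; rewrite /= mulrC.
  have Mxj j : J j -> M (x * j).
    move=> Jj; apply: BsubM; split; first exact: QJD.
    by move=> q Qq; rewrite -mulrA mulKf // mulrC; apply: QJD.
  have xQQJ : t_closure D (ideal_mul (ideal_mul (Q M) (Q M)) J) x.
    by rewrite -eqQ; apply: sub_t_closure.
  (* Divide [x] by itself inside the closure of Q^2 J: every [x^-1 * (q * q' * j)] is the product of
     two elements of D_M and of [x * j], which lies in [M]. So 1 would lie in M D_M. *)
  have [s [Ds Ms]] : loc D M M 1.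
    suff : loc D M (t_closure D M) (x^-1 * x).
      by rewrite mulVf //; apply: loc_mono; apply: t_maximal_closed.
    apply: (t_closure_loc domD pM smM); apply: t_closure_scale.
    move: xQQJ; apply: t_closure_mono; apply: (@ideal_mul3_sub _ D).
      apply: submodule_scale.
      by apply: (loc_submodule domD pM); apply: submodule_loc.
    move=> q q' j [Dq Mq] [Dq' Mq'] Jj /=.
    have -> : x^-1 * (q * q' * j) = (x^-1 * q) * ((x^-1 * q') * (x * j)) by field.
    by do 2!(apply: loc_mul => //); apply: sub_loc => //; apply: Mxj.
  by rewrite mulr1.
pose U := [set y | y = x \/ exists M, [/\ t_maximal D M, M x & B M y]].
have UD : U `<=` D by move=> y [->//|[M [_ _ []]]].
have Ux : U x by left.
have [s sU Ds] : t_closure D U 1.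
  apply: contrapT => U1.
  have clUD : t_closure D U `<=` D.
    by apply: subset_trans (@t_closure_dom _ D); apply: t_closure_mono.
  have [|N tN UN] := sub_t_maximal domD _ clUD (@t_closure_id _ _ _) U1.
    apply: integral_ideal => //; first exact: submodule_t_closure.
    by exists x => //; apply: sub_t_closure.
  have Nx : N x by apply: UN; apply: sub_t_closure.
  apply: (BM N tN Nx) => y BNy; apply: UN; apply: sub_t_closure.
  by right; exists N.
(* A t-maximal [N] containing all of the list [s] would contain 1, so each [N] above [x] omits some
   entry. *)
apply: (@sub_finite_set _ _
    [set N | [/\ t_maximal D N, N x & exists2 g, g \in s & ~ N g]]).
  move=> N [tN Nx]; split=> //; apply: contrapT => sN.
  have pN := t_maximal_prime domD tN; apply: (prime_not1 pN).
  apply: (t_maximal_closed domD tN); exists s => // g gs.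
  by apply: contrapT => Ng; apply: sN; exists g.
(* The entry [x] is omitted by no [N] above [x], and an entry taken from [B M] can be omitted only
   by [M]. Each entry thus contributes at most one ideal. *)
elim: s sU {Ds} => [|g s IHs] sU.
  by rewrite (_ : mkset _ = set0) //; apply/seteqP; split=> // N [_ _ []].
have [] := sU g; first by rewrite inE eqxx.
  move=> gx; apply: sub_finite_set (IHs _); last first.
    by move=> h hs; apply: sU; rewrite inE hs orbT.
  move=> N [tN Nx [h]]; rewrite inE => /predU1P[->|hs Nh]; first by rewrite gx.
  by split=> //; exists h.
move=> [M [tM Mx BMg]].
apply: (@sub_finite_set _ _ ([set M] `|`
    [set N | [/\ t_maximal D N, N x & exists2 g, g \in s & ~ N g]])).
  move=> N [tN Nx [h]]; rewrite inE => /predU1P[->|hs] Nh.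
    left; apply: contrapT => neqNM; apply: Nh; apply: (BN M) => //.
    by move=> eqMN; apply: neqNM.
  by right; split=> //; exists h.
rewrite finite_setU; split; first exact: finite_set1.
by apply: IHs => h hs; apply: sU; rewrite inE hs orbT.
Qed.

(** * Gluing local data under t-finite character *)

Section FiniteCharacter.
Hypothesis finD : t_finite_character D.

(** For [c = a / b], only the finitely many [N] containing [b] can fail to have [c] in D_N; multiply
    the elements that independence gives for these. *)
Lemma t_finite_character_den M c : t_maximal D M ->
  exists u, [/\ D u, ~ M u &
    forall N, t_maximal D N -> N <> M -> loc D N D (u * c)].
Proof.
move=> tM; have pM := t_maximal_prime domD tM.
have [a [b [Da Db b0 def_c]]] := dom_frac domD c.
have /finite_seqP[s def_s] := finD Db b0.
have DZ N u : t_maximal D N -> D u -> loc D N D c -> loc D N D (u * c).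
  move=> tN Du [t [Dt Nt Dtc]]; exists t; split=> //.
  by rewrite mulrCA; apply: dom_mul.
suff [u [Du Mu uc]] : exists u, [/\ D u, ~ M u & forall N : set K, N \in s ->
    t_maximal D N -> N <> M -> loc D N D (u * c)].
  exists u; split=> // N tN neqNM; have [Nb|Nb] := pselect (N b).
    by apply: uc => //; have : [set M | t_maximal D M /\ M b] N by []; rewrite def_s.
  by apply: DZ => //; exists b; split=> //; rewrite def_c mulrCA divff ?mulr1.
elim: s {def_s} => [|N s [u [Du Mu uc]]].
  by exists 1; split=> //; [exact: dom1 | exact: (prime_not1 pM)].
have [[tN neqNM]|] := pselect (t_maximal D N /\ N <> M); last first.
  move=> notN; exists u; split=> // N'; rewrite inE => /predU1P[->|]; last exact: uc.
  by move=> ? ?; case: notN.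
have [v [Dv Mv vc]] := t_maximal_independent c tM tN (nesym neqNM).
exists (u * v); split; [exact: dom_mul | exact: (prime_notM pM) |] => N'.
rewrite inE => /predU1P[->|sN'] tN' neqN'M.
  case: vc => t [Dt Nt Dtc]; exists t; split=> //.
  by rewrite -mulrA mulrCA; apply: dom_mul.
have [t [Dt Nt Dtc]] := uc _ sN' tN' neqN'M; exists t; split=> //.
by rewrite (_ : _ * _ = v * (t * (u * c))); [apply: dom_mul | ring].
Qed.

(** At [M] the given witness list works once its denominators are cleared by [v]. At the other [N],
    a nonzero [z] of [A] added to the list bounds the test element [k], and [u] clears
    [v * y / z]. *)
Lemma t_closure_loc_sub M A : t_maximal D M -> ideal D A ->
  t_closure (loc D M D) (loc D M A) `<=` loc D M (t_closure D A).
Proof.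
move=> tM idA y [s sA Ds]; have pM := t_maximal_prime domD tM.
have smA := ideal_submodule idA.
have [v [Dv Mv vA]] := loc_common_den domD pM smA sA.
have [z Az z0] := ideal_neq0 idA.
have [u [Du Mu uy]] := t_finite_character_den (v * y / z) tM.
exists (u * v); split; [exact: dom_mul | exact: (prime_notM pM) |].
exists (z :: [seq v * g | g <- s]).
  by move=> g; rewrite inE => /predU1P[->//|/mapP[h /vA ? ->]].
move=> k Dk; have Dkz : D (k * z) by apply: Dk; rewrite inE eqxx.
apply: (t_local_global domD (ideal_dom domD)); first exact: t_closure_dom.
move=> N tN; have pN := t_maximal_prime domD tN.
have [->|neqNM] := pselect (N = M).
  have [|t [Dt Mt Dtyvk]] := Ds (v * k).
    move=> g gs; apply: sub_loc => //; rewrite -mulrA mulrCA; apply: Dk.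
    by rewrite inE map_f ?orbT.
  exists t; split=> //; rewrite (_ : _ * _ = u * (t * (y * (v * k)))); last by ring.
  exact: dom_mul.
have [t [Dt Nt Dtu]] := uy N tN neqNM; exists t; split=> //.
rewrite (_ : _ * _ = t * (u * (v * y / z)) * (k * z)); last by field.
exact: dom_mul.
Qed.

(** Membership in [A] is tested locally. Away from [M], the factorization of [y * b] as
    [y / (d * a)] times [d * b] times [a] reduces it to a [u] that clears the first factor at every
    other t-maximal ideal. *)
Lemma colon_loc_sub M A B y d : t_maximal D M -> ideal D A -> t_closure D A `<=` A ->
  D d -> d != 0 -> (forall b, B b -> D (d * b)) ->
  (forall b, B b -> loc D M A (y * b)) -> loc D M (colon A B) y.
Proof.
move=> tM idA clA Dd d0 dB yB; have pM := t_maximal_prime domD tM.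
have AZ : forall r x, D r -> A x -> A (r * x) by case: (ideal_submodule idA).
have [a Aa a0] := ideal_neq0 idA.
have [u [Du Mu uy]] := t_finite_character_den (y / (d * a)) tM.
exists u; split=> // b Bb; apply: (t_local_global domD idA clA) => N tN.
have [->|neqNM] := pselect (N = M).
  have [t [Dt Mt Atyb]] := yB b Bb; exists t; split=> //.
  by rewrite (_ : _ * _ = u * (t * (y * b))); [apply: AZ | ring].
have [t [Dt Nt Dtu]] := uy N tN neqNM; exists t; split=> //.
rewrite (_ : _ * _ = t * (u * (y / (d * a))) * (d * b) * a); last by field; apply/andP.
by apply: AZ => //; apply: dom_mul => //; apply: dB.
Qed.

Lemma clifford_t_regular_glue :
  (forall M, t_maximal D M -> clifford_t_regular (loc D M D)) ->
  clifford_t_regular D.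
Proof.
move=> cliff; apply/(clifford_t_regular_closure domD) => I idI.
set L := t_closure D I; have idL : ideal D L by apply: ideal_t_closure.
have idII := ideal_mul_ideal domD idI idI.
(* The largest candidate: any ideal satisfying the equation is contained in it, so it can be
   compared with every local solution. *)
set J := colon L (ideal_mul I I).
have idJ : ideal D J by apply: ideal_colon.
have idIIJ := ideal_mul_ideal domD idII idJ.
exists J => //; apply/seteqP; split; last first.
  apply: t_closure_sub; apply: (ideal_mul_sub (ideal_submodule idL)) => z j IIz Jj.
  by rewrite mulrC; apply: Jj.
move=> y Ly; apply: (t_local_global domD (ideal_t_closure domD idIIJ)).
  exact: t_closure_id.
move=> M tM; have pM := t_maximal_prime domD tM.
have domDM := fraction_domain_loc domD pM.
have [J' idJ' eqI] :=
  (clifford_t_regular_closure domDM).1 (cliff M tM) _ (ideal_loc domD pM idI).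
apply: (t_closure_loc_sub tM idIIJ).
have : t_closure (loc D M D) (loc D M I) y.
  by apply: t_closure_mono (t_closure_sub_local domD pM Ly); apply: sub_loc.
rewrite eqI; apply: t_closure_mono.
apply: (ideal_mul3_sub (ideal_submodule (ideal_loc domD pM idIIJ))).
move=> a b j [u [Du Mu Iua]] [v [Dv Mv Ivb]] J'j.
have [d [Dd d0 dII]] := ideal_den idII.
(* The local solution [J'] multiplies I^2 into the closure of I_M, which lies in L_M; hence [j] lies
   in J_M. *)
have [|w [Dw Mw Jwj]] := @colon_loc_sub M L (ideal_mul I I) j d tM idL
  (@t_closure_id _ _ _) Dd d0 dII.
  move=> c IIc; apply: (t_closure_loc_sub tM idI); rewrite eqI; apply: sub_t_closure.
  rewrite mulrC; apply: mem_ideal_mul => //; move: c IIc.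
  have smI_M := submodule_loc domD pM (ideal_submodule idI).
  apply: (ideal_mul_sub (loc_submodule domD pM (submodule_mul _ smI_M))).
  by move=> p q Ip Iq; apply: mem_ideal_mul; apply: sub_loc.
exists (u * v * w); split; [by do 2!apply: dom_mul => // | |].
  by apply: (prime_notM pM) => //; [apply: dom_mul | apply: (prime_notM pM)].
rewrite (_ : _ * _ = (u * a) * (v * b) * (w * j)); last by ring.
by do 2!apply: mem_ideal_mul => //.
Qed.

Lemma t_stable_glue :
  (forall M, t_maximal D M -> t_stable (loc D M D)) -> t_stable D.
Proof.
move=> stab; apply/(t_stable_closure domD) => I idI.
set L := t_closure D I; have idL : ideal D L by apply: ideal_t_closure.
set E := colon L L; have idE : ideal D E by apply: ideal_colon.
set G := colon E L; have idG : ideal D G by apply: ideal_colon.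
have idLG := ideal_mul_ideal domD idL idG; have idLL := ideal_mul_ideal domD idL idL.
apply/seteqP; split.
  apply: subset_trans (@t_closure_colon _ _ _ _ (@t_closure_id _ _ _)).
  apply: t_closure_mono; apply: (ideal_mul_sub (ideal_submodule idE)) => l g Ll Gg.
  by rewrite mulrC; apply: Gg.
move=> y Ey; apply: (t_local_global domD (ideal_t_closure domD idLG)).
  exact: t_closure_id.
move=> M tM; have pM := t_maximal_prime domD tM.
have domDM := fraction_domain_loc domD pM.
have := (t_stable_closure domDM).1 (stab M tM) _ (ideal_loc domD pM idI).
set H := t_closure _ _; set E' := colon H H => /= eqE.
have HL : H `<=` loc D M L by apply: t_closure_loc_sub.
have LH : L `<=` H.
  by move=> l /(t_closure_sub_local domD pM); apply: t_closure_mono; apply: sub_loc.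
have smH : submodule (loc D M D) H by apply: submodule_t_closure.
apply: (t_closure_loc_sub tM idLG).
have : E' y.
  move=> h /HL [u [Du Mu Luh]]; apply: (loc_loc domD pM smH).
  by exists u; split=> //; rewrite mulrCA; apply: LH; apply: Ey.
rewrite /E' -eqE; apply: t_closure_mono.
apply: (ideal_mul_sub (ideal_submodule (ideal_loc domD pM idLG))).
move=> h g /HL[u [Du Mu Luh]] G'g; have [d [Dd d0 dLL]] := ideal_den idLL.
(* The nested colon (E : L) is (L : L^2), so one application of [colon_loc_sub] suffices to bring
   [g] into its localization. *)
have [|w [Dw Mw LLwg]] := @colon_loc_sub M L (ideal_mul L L) g d tM idL
  (@t_closure_id _ _ _) Dd d0 dLL.
  move=> c LLc; apply: HL; move: c LLc.
  apply: (ideal_mul_sub (submodule_scale g (loc_submodule domD pM smH))).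
  move=> l l' Ll Ll' /=.
  by rewrite mulrA; apply: G'g; apply: LH.
exists (u * w); split; [exact: dom_mul | exact: (prime_notM pM) |].
rewrite mulrACA; apply: mem_ideal_mul => // l Ll l' Ll'.
by rewrite -mulrA; apply: LLwg; apply: mem_ideal_mul.
Qed.

End FiniteCharacter.
End Independence.

(** * Transfer to the field of fractions of [R], and the equivalences *)

Lemma fraction_domain_in_fractions (R : idomainType) :
  fraction_domain (domain_in_fractions R).
Proof.
split.
- by exists 1; rewrite ?tofrac1.
- by move=> _ _ [a _ <-] [b _ <-]; exists (a - b); rewrite ?tofracB.
- by move=> _ _ [a _ <-] [b _ <-]; exists (a * b); rewrite ?tofracM.
- elim/quotW=> r; exists (tofrac \n_r), (tofrac \d_r).
  have d0 : \d_r != 0 by exact: denom_ratioP.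
  split; [by exists \n_r | by exists \d_r | by rewrite tofrac_eq0 |].
  apply: (canRL (mulfK _)); first by rewrite tofrac_eq0.
  rewrite !piE; apply/eqmodP; rewrite /= FracField.equivfE.
  by rewrite !numden_Ratio ?mulf_neq0 ?oner_neq0 // !mulr1 mulrC.
Qed.

Unset Implicit Arguments.

Theorem corollary5p8 (R : idomainType) :
  let D := domain_in_fractions R in
  (forall P : set {fraction R}, t_prime D P ->
     exists! M : set {fraction R}, t_maximal D M /\ P `<=` M) ->
  (clifford_t_regular D <->
     (forall M : set {fraction R}, t_maximal D M ->
        clifford_t_regular (localization D M)) /\
     t_finite_character D) /\
  (t_stable D <->
     (forall M : set {fraction R}, t_maximal D M ->
        t_stable (localization D M)) /\
     t_finite_character D).
Proof.
move=> D t_primeP; have domD : fraction_domain D := fraction_domain_in_fractions R.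
have locE M : t_maximal D M -> localization D M = loc D M D.
  by move=> /(t_maximal_prime domD)/localizationE.
split; split.
- move=> cliff; split; last exact: clifford_t_finite_character.
  move=> M tM; rewrite locE //; apply: clifford_t_regular_loc => //.
  exact: t_maximal_prime.
- move=> [cliff finD]; apply: clifford_t_regular_glue => // M tM.
  by rewrite -locE //; apply: cliff.
(* Finite character is inherited from the Clifford case, since stability implies Clifford
   regularity. *)
- move=> stab; split; last exact/clifford_t_finite_character/t_stable_clifford.
  move=> M tM; rewrite locE //; apply: t_stable_loc => //.
  exact: t_maximal_prime.
- move=> [stab finD]; apply: t_stable_glue => // M tM.
  by rewrite -locE //; apply: stab.
Qed.
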